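(* Let $q\in(0,1)$ be a rational number (a vertex of the S-tree) with continued fraction $q=[0,a_1,\dots,a_k]$. Then $q$ is the $N$-th vertex (counted from the left, starting at 1) in level $M$ of the S-tree, where $$M=-1+\sum_{i=1}^{k}a_i,\qquad N=1+\sum_{i=1}^{k-1}2^{\left(-1+\sum_{j=1}^{i}a_j\right)}$$ (when $k=1$, $N=1$).
   Context: The S-tree is the infinite binary tree of fractions defined as follows. Level 0 consists of the single vertex $\frac{1}{1}$, which has exactly one child, $\frac{1}{2}$, in level 1. Every vertex $\frac{m}{n}$ in level $k\ge 1$ has a left child $\frac{m}{m+n}$ and a right child $\frac{n}{m+n}$ in level $k+1$. Vertices of a level are ordered from left to right in the usual way. $[a_0,a_1,\dots,a_k]$ denotes the continued fraction $a_0+\cfrac{1}{a_1+\cfrac{1}{\ddots+\cfrac{1}{a_k}}}$, where $a_1,\dots,a_k$ are positive integers and, by convention, the last entry satisfies $a_k\ge 2$. *)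

(* Defs.v *)
From mathcomp Require Import all_boot all_order all_algebra.

Set Implicit Arguments.
Unset Strict Implicit.
Unset Printing Implicit Defensive.

Import GRing.Theory Num.Theory.

Local Open Scope ring_scope.

(* A fraction m/n is the formal pair (m, n). *)
Definition fraction : Type := (nat * nat)%type.

Definition fraction_value (v : fraction) : rat := v.1%:R / v.2%:R.

Definition S_children (v : fraction) : seq fraction :=
  let: (m, n) := v in [:: (m, (m + n)%N); (n, (m + n)%N)].

(* The vertices of level k from left to right.  The root 1/1 is exceptional:
   its only child is 1/2, so level 1 is given explicitly. *)
Fixpoint S_level (k : nat) : seq fraction :=
  match k with
  | 0%N => [:: (1%N, 1%N)]
  | k'.+1 => if k' is 0%N then [:: (1%N, 2%N)]
             else flatten [seq S_children v | v <- S_level k']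
  end.

(* Positions are counted from 1; [onth] counts from 0 and returns [None] past
   the end of the level. *)
Definition is_nth_vertex_of_level (q : rat) (N M : nat) : Prop :=
  (0 < N)%N /\ onth [seq fraction_value v | v <- S_level M] N.-1 = Some q.

(* [cfrac a0 [:: a1; ...; ak]] is the value of [a0, a1, ..., ak]. *)
Fixpoint cfrac (a0 : int) (s : seq nat) : rat :=
  if s is a1 :: s' then a0%:~R + (cfrac a1%:Z s')^-1 else a0%:~R.

(* a_1, ..., a_k are the values of a at 1, ..., k; its other values are
   irrelevant. *)
Definition is_cfrac_expansion (q : rat) (a0 : int) (k : nat) (a : nat -> nat)
    : Prop :=
  [/\ forall i, (1 <= i <= k)%N -> (0 < a i)%N,
      (0 < k)%N -> (2 <= a k)%N &
      q = cfrac a0 [seq a i | i <- iota 1 k]].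

(* Main.v *)
(** Since m/(m+n) = 1/(1 + 1/q) and n/(m+n) = 1/(1 + q) for q = m/n, passing to
    the left child turns [0,a_1,...,a_k] into [0,1+a_1,a_2,...,a_k], and passing
    to the right child turns it into [0,1,a_1,...,a_k].  The 0-based position i
    becomes 2i, respectively 2i+1.  Hence [0,a_1,...,a_k] is reached from
    [0,a_2,...,a_k] by one right step followed by a_1 - 1 left steps. *)

Require Import Defs.
From mathcomp Require Import all_boot all_order all_algebra.
From mathcomp Require Import zify.

Import GRing.Theory Num.Theory.

Local Open Scope ring_scope.

(* The level is recorded as [t - 1] because [t] is then the sum of the partial
   quotients of [x]; positions [i] are counted from 0. *)
Definition S_located (x : rat) (i t : nat) : Prop :=
  exists m n : nat, [/\ (1 < t)%N, (0 < m)%N, (0 < n)%N,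
    onth (S_level t.-1) i = Some (m, n) & x = m%:R / n%:R].

Lemma onth_S_children (s : seq fraction) (i m n : nat) :
  onth s i = Some (m, n) ->
  onth (flatten [seq S_children v | v <- s]) i.*2 = Some (m, (m + n)%N) /\
  onth (flatten [seq S_children v | v <- s]) i.*2.+1 = Some (n, (m + n)%N).
Proof.
elim: s i => [|[p r] s IHs] [|i] //=; first by case=> -> ->.
exact: IHs.
Qed.

Lemma S_located_half : S_located (2%:R)^-1 0 2.
Proof. by exists 1%N, 2%N; split; rewrite ?mul1r. Qed.

Lemma inv_add1_div (m n : nat) : (0 < n)%N ->
  (1 + m%:R / n%:R)^-1 = n%:R / (m + n)%:R :> rat.
Proof.
move=> n_gt0; have n_neq0 : n%:R != 0 :> rat by rewrite pnatr_eq0 -lt0n.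
by rewrite -[RHS]invf_div natrD mulrDl divff // addrC.
Qed.

Lemma S_located_left (x : rat) (i t : nat) :
  S_located x i t -> S_located (1 + x^-1)^-1 i.*2 t.+1.
Proof.
(* The bound [1 < t] excludes the root, the only vertex without two children. *)
case: t => [|[|t]] [m [n [//= _ m0 n0 /onth_S_children[onth_left _] ->]]].
exists m, (m + n)%N; split=> //; first by rewrite addn_gt0 m0.
by rewrite invf_div inv_add1_div // addnC.
Qed.

Lemma S_located_right (x : rat) (i t : nat) :
  S_located x i t -> S_located (1 + x)^-1 i.*2.+1 t.+1.
Proof.
case: t => [|[|t]] [m [n [//= _ m0 n0 /onth_S_children[_ onth_right] ->]]].
exists n, (m + n)%N; split=> //; first by rewrite addn_gt0 m0.
by rewrite inv_add1_div.
Qed.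

Lemma S_located_iter_left (c : nat) (x : rat) (i t : nat) :
  S_located x i t -> S_located (c%:R + x^-1)^-1 (2 ^ c * i) (c + t).
Proof.
move=> loc_x; elim: c => [|c IHc]; first by rewrite add0r invrK mul1n.
move/S_located_left: IHc; rewrite invrK addrA -mulrS -mul2n mulnA -expnS.
by [].
Qed.

Lemma cfrac0_cons (c : nat) (s : seq nat) :
  cfrac 0 (c :: s) = (c%:R + cfrac 0 s)^-1.
Proof. by case: s => [|d s] /=; rewrite ?addr0 !add0r. Qed.

(** Indexing the quotients from 0 makes [b \o S] the tail to which the induction hypothesis
    applies. *)
Lemma S_located_cfrac (k : nat) (b : nat -> nat) :
  (forall i, (i <= k)%N -> (0 < b i)%N) -> (2 <= b k)%N ->
  S_located (cfrac 0 (mkseq b k.+1))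
    (\sum_(0 <= i < k) 2 ^ (\sum_(0 <= j < i.+1) b j - 1))
    (\sum_(0 <= i < k.+1) b i).
Proof.
elim: k b => [|k IHk] b b_gt0 bk_ge2.
  rewrite big_geq // big_nat1 /= add0r.
  (* The chain starts at 1/2 = [0,2], so the last quotient takes two fewer left steps than its
     value. *)
  have := S_located_iter_left (b 0%N - 2) _ _ _ S_located_half.
  by rewrite invrK muln0 -natrD subnK.
have b0_gt0 : (0 < b 0)%N by apply: b_gt0.
have := IHk (b \o S) (fun i => b_gt0 i.+1) bk_ge2.
move/S_located_right/(S_located_iter_left (b 0%N - 1)).
have -> : mkseq b k.+2 = b 0%N :: mkseq (b \o S) k.+1.
  by rewrite /mkseq /= -[2%N]addn1 -[1%N]addn0 !iotaDl -!map_comp.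
rewrite cfrac0_cons invrK addrA natrB // subrK.
set t := (_ + _.+1)%N; set N := (_ * _)%N => loc.
have <- : t = (\sum_(0 <= i < k.+2) b i)%N.
  by rewrite /t [RHS]big_nat_recl //=; lia.
suff <- : N = (\sum_(0 <= i < k.+1) 2 ^ (\sum_(0 <= j < i.+1) b j - 1))%N by [].
(* With P the position in the tail, 2^(b_0 - 1) (2P + 1) = 2^(b_0 - 1) + 2^(b_0) P: the right step
   gives the term at 0, and the factor 2^(b_0) adds b_0 to each exponent in P. *)
rewrite big_nat_recl // big_nat1 /N -mul2n mulnS mulnA -expnSr subn1 prednK //.
congr addn; rewrite big_distrr /=; apply: eq_big_nat => i /andP[_ lt_ik].
rewrite -expnD [in RHS]big_nat_recl //= addnBA //.
by rewrite big_nat_recl // ltn_addr // b_gt0.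
Qed.

(* The truncated subtractions of 1 are genuine: each sum below is at least 1,
   since k >= 1 and the a_i are positive. *)
Theorem theorem4 (q : rat) (k : nat) (a : nat -> nat)
    (hq : 0 < q < 1) (hk : (1 <= k)%N)
    (ha : is_cfrac_expansion q 0 k a) :
  let M := (\sum_(1 <= i < k.+1) a i - 1)%N in
  let N := (1 + \sum_(1 <= i < k) 2 ^ (\sum_(1 <= j < i.+1) a j - 1))%N in
  is_nth_vertex_of_level q N M.
Proof.
case: k hk ha => // k _ [a_gt0 /(_ isT) ak_ge2 ->] M N.
have := S_located_cfrac k (a \o S) (fun i => a_gt0 i.+1) ak_ge2.
rewrite /mkseq map_comp -(iotaDl 1 0) => -[m [n [_ _ _ onth_mn ->]]].
split=> //; rewrite /N /M add1n /= onth_map subn1 !big_add1 /=.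
under [X in onth _ X]eq_bigr do rewrite big_add1.
by rewrite onth_mn.
Qed.
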